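(* Assume the Continuum Hypothesis. Let $\mathbb G,\mathbb H\subseteq\mathbb E$ be such that $\mathbb H$ is dense, shrinkable and $\mathbb G$-large. Then there is a zero-dimensional Hausdorff topology $\tau$ on the set $X=C\cup\omega_1$ (disjoint union) such that (i) $X$ has countable tightness, and $\omega_1$ is left-separated in its natural order; (ii) $C$ is a dense open subspace of $X$ and $\tau\restriction C$ is the natural topology $\varepsilon$ of $C$; (iii) $\overline{R(g)}\cap\omega_1=\emptyset$ for each $g\in\mathbb G$; (iv) $\overline{R(h)}\cap\omega_1\ne\emptyset$ for each $h\in\mathbb H$, where closures are taken in $(X,\tau)$.
   Context: For $n\in\omega$ let $C_n=\{n\}\times 2^\omega$ and $C=\bigcup_n C_n$; $\varepsilon$ denotes the natural topology on $C$ (product of discrete $\omega$ and the Cantor space). $\mathbb E$ is the set of functions $e$ with $\mathrm{dom}(e)$ an infinite subset of $\omega$ and $\emptyset\ne e(n)\subseteq C_n$ for $n\in\mathrm{dom}(e)$; $\mathbb O=\{o\in\mathbb E: o(n) \text{ is clopen in } C_n \text{ for all } n\in\mathrm{dom}(o)\}$. For $e\in\mathbb E$, $R(e)=\bigcup_{n\in\mathrm{dom}(e)}e(n)$. For $f,g\in\mathbb E$: $f\sqsubset g$ iff $\mathrm{dom}(f)\subseteq\mathrm{dom}(g)$ and $f(n)\subseteq g(n)$ for all $n\in\mathrm{dom}(f)$; $f\sqsubseteq^* g$ iff $\mathrm{dom}(f)\setminus\mathrm{dom}(g)$ is finite and $\{n\in\mathrm{dom}(f): f(n)\not\subseteq g(n)\}$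 is finite; $f\perp g$ iff $\{n\in\mathrm{dom}(f)\cap\mathrm{dom}(g): f(n)\cap g(n)\ne\emptyset\}$ is finite. For $h,o\in\mathbb E$, $h\dot- o$ is the function with domain $\{n\in\mathrm{dom}(h):h(n)\not\subseteq o(n)\}$ (where $h(n)\not\subseteq o(n)$ holds automatically if $n\notin\mathrm{dom}(o)$) and $(h\dot- o)(n)=h(n)\setminus o(n)$ if $n\in\mathrm{dom}(o)$, $(h\dot- o)(n)=h(n)$ otherwise. For $\mathbb G,\mathbb H\subseteq\mathbb E$: $\mathbb H$ is dense iff for each $o\in\mathbb O$ there is $h\in\mathbb H$ with $h\sqsubset o$; $\mathbb H$ is shrinkable iff for each $h\in\mathbb H$ and each countable $\mathcal O\subseteq\mathbb O$ there is $h'\in\mathbb H$ with $h'\sqsubset h$ and, for every $o\in\mathcal O$, $h'\sqsubseteq^* o$ or $h'\perp o$; $\mathbb H$ is $\mathbb G$-large iff for each $g\in\mathbb G$ and each countable $\mathcal H\subseteq\mathbb H$ there is $o\in\mathbb O$ with $g\sqsubset o$ and $h\dot- o\in\mathbb H$ for each $h\in\mathcal H$. A subset $Y$ well-ordered by an order is left-separated in that order if every initial segment of $Y$ is closed in $Y$. *)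

(* Defs.v *)
From HB Require Import structures.
From mathcomp Require Import all_boot all_order all_algebra.
From mathcomp Require Import all_classical all_reals all_analysis.
Set Implicit Arguments. Unset Strict Implicit. Unset Printing Implicit Defensive.
Local Open Scope classical_set_scope.

(* C = omega x 2^omega with the natural topology epsilon
   (product of discrete nat and the Cantor space, as in the library). *)
Definition Cset : Type := (nat * cantor_space)%type.

Definition Cn (n : nat) : set Cset := [set c | c.1 = n].

(* Elements of E are represented by  e : nat -> set Cset  with
   dom(e) = [set n | e n != set0]  (so values outside the domain are empty). *)
Definition Efun : Type := nat -> set Cset.

Definition dom (e : Efun) : set nat := [set n | e n !=set0].

Definition inE_ (e : Efun) : Prop :=
  infinite_set (dom e) /\ (forall n, e n `<=` Cn n).

Definition clopen_in_Cn (n : nat) (A : set Cset) : Prop :=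
  (exists U : set Cset, open U /\ A = U `&` Cn n) /\
  (exists F : set Cset, closed F /\ A = F `&` Cn n).

Definition inO (o : Efun) : Prop :=
  inE_ o /\ (forall n, dom o n -> clopen_in_Cn n (o n)).

Definition Rg (e : Efun) : set Cset := \bigcup_(n in dom e) e n.

Definition sqsub (f g : Efun) : Prop :=
  dom f `<=` dom g /\ (forall n, dom f n -> f n `<=` g n).

Definition sqsub_star (f g : Efun) : Prop :=
  finite_set (dom f `\` dom g) /\
  finite_set [set n | dom f n /\ ~ (f n `<=` g n)].

Definition perp (f g : Efun) : Prop :=
  finite_set [set n | dom f n /\ dom g n /\ (f n `&` g n !=set0)].

(* h -. o : domain {n in dom h | h n not subset of o n};
   value h n \ o n (which is h n when n is not in dom o, since then o n = set0). *)
Definition edot (h o : Efun) : Efun := fun n => h n `\` o n.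

Definition denseE (H : set Efun) : Prop :=
  forall o, inO o -> exists2 h, H h & sqsub h o.

Definition shrinkable (H : set Efun) : Prop :=
  forall h, H h -> forall Os : set Efun, countable Os -> Os `<=` inO ->
    exists2 h', H h' & sqsub h' h /\
      (forall o, Os o -> sqsub_star h' o \/ perp h' o).

Definition large (G H : set Efun) : Prop :=
  forall g, G g -> forall Hs : set Efun, countable Hs -> Hs `<=` H ->
    exists o, inO o /\ sqsub g o /\ (forall h, Hs h -> H (edot h o)).

Definition is_omega1 (W : Type) (lt : W -> W -> Prop) : Prop :=
  (forall x, ~ lt x x) /\
  (forall x y z, lt x y -> lt y z -> lt x z) /\
  (forall x y, lt x y \/ x = y \/ lt y x) /\
  well_founded lt /\
  (forall x, countable [set y | lt y x]) /\
  ~ countable [set: W].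

Definition CH_for (W : Type) : Prop :=
  exists f : W -> cantor_space, bijective f.

Definition t_is_topology (X : Type) (tau : set (set X)) : Prop :=
  tau set0 /\ tau setT /\
  (forall F : set (set X), F `<=` tau -> tau (\bigcup_(A in F) A)) /\
  (forall A B, tau A -> tau B -> tau (A `&` B)).

Definition t_closure (X : Type) (tau : set (set X)) (A : set X) : set X :=
  [set x | forall V, tau V -> V x -> V `&` A !=set0].

Definition t_closed (X : Type) (tau : set (set X)) (A : set X) : Prop :=
  tau (~` A).

Definition t_clopen (X : Type) (tau : set (set X)) (A : set X) : Prop :=
  tau A /\ t_closed tau A.

Definition t_zero_dimensional (X : Type) (tau : set (set X)) : Prop :=
  forall V x, tau V -> V x -> exists U, t_clopen tau U /\ U x /\ U `<=` V.

Definition t_hausdorff (X : Type) (tau : set (set X)) : Prop :=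
  forall x y, x <> y -> exists U V, tau U /\ tau V /\ U x /\ V y /\ U `&` V = set0.

Definition t_countable_tightness (X : Type) (tau : set (set X)) : Prop :=
  forall (A : set X) x, t_closure tau A x ->
    exists2 B, B `<=` A /\ countable B & t_closure tau B x.

(* Y = f @` [set: W] (an injective copy of W in X) is left-separated in the
   order lt: every initial segment of Y is closed in the subspace Y. *)
Definition t_left_separated (X W : Type) (tau : set (set X)) (f : W -> X)
  (lt : W -> W -> Prop) : Prop :=
  forall I : set W, (forall x y, I x -> lt y x -> I y) ->
    forall w, t_closure tau (f @` I) (f w) -> I w.

(* Main.v *)
Require Import Defs.
From HB Require Import structures.
From mathcomp Require Import all_boot all_order all_algebra.
From mathcomp Require Import all_classical all_reals all_analysis.
Set Implicit Arguments. Unset Strict Implicit. Unset Printing Implicit Defensive.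
Local Open Scope classical_set_scope.

(** The topology has a clopen subbase indexed by the layers [n], the half-spaces
    [x i = true] and two sets per ordinal [a]; each is given by its trace on C, and
    the point [g] of omega_1 belongs to it iff a fixed member [seed g] of H is
    almost included (mod finitely many layers) in the trace. The traces
    are chosen by recursion on [a] so that every cell of the finite Boolean algebra
    around [g] still contains, modulo finitely many layers, a member of H
    ("positive"); largeness preserves this when an o covering some element of G is
    added, shrinkability lets [seed a] decide all earlier traces, and density
    together with a branch of the Cantor space avoiding countably many others
    provides a seed whose type is new. At stage [a] a given h in H, shrunk so as to
    decide the earlier traces, either has the type of an old point and is attached
    to it, or has a new type and becomes the seed of [a].
    Since h and o matter only through the closures of their layers, continuum many
    codes suffice for G and H.
    Both sets added at stage [a] miss all points before [a]. Thus initial segments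
    are closed, and a countable set of points closed under initial segments and
    under picking witnesses for the finitely many sets named so far witnesses
    countable tightness. *)

(** * Finite and countable sets *)

Section FiniteCountable.

Lemma finite_set_ind (T : Type) (Q : set T -> Prop) :
  Q set0 -> (forall x A, finite_set A -> Q A -> Q (x |` A)) ->
  forall A, finite_set A -> Q A.
Proof.
move=> Q0 QU A [n]; elim: n A => [|n IHn] A.
  by rewrite II0 card_eq0 => /eqP ->.
move=> /eq_cardSP [x Ax AxE]; rewrite -(@setDUK _ [set x] A); last by move=> _ ->.
by apply: QU; [exists n | exact: IHn].
Qed.

Lemma filter_finite_forall (T I : Type) (F : set_system T) (A : set I)
    (P : I -> T -> Prop) : Filter F -> finite_set A ->
  (forall i, A i -> \forall x \near F, P i x) ->
  \forall x \near F, forall i, A i -> P i x.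
Proof.
move=> FF; move: A; apply: finite_set_ind => [_|i A _ IH FP].
  exact: filterS filterT.
apply: filterS2 (FP i (or_introl erefl)) (IH (fun j Aj => FP j (or_intror Aj))).
by move=> x Pi PA j [->|/PA].
Qed.

(** Places a finite set of indices inside a single stage, so that successor and limit stages need no
    separate treatment. *)
Lemma finite_directed (T I : Type) (D : set I) (P : I -> T -> Prop) :
    D !=set0 ->
    (forall i j, D i -> D j -> exists2 k, D k & P i `|` P j `<=` P k) ->
  forall A, finite_set A -> A `<=` \bigcup_(i in D) P i ->
  exists2 i, D i & A `<=` P i.
Proof.
move=> [i0 Di0] dirP; apply: finite_set_ind => [_|x A _ IH AP].
  by exists i0.
have [i Di AiP] := IH (subset_trans (@subsetUr _ _ _) AP).
have [j Dj Pjx] := AP x (or_introl erefl).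
have [k Dk ijk] := dirP _ _ Di Dj; exists k => // y [->|/AiP Piy].
  by apply: ijk; right.
by apply: ijk; left.
Qed.

Lemma countable_image (T U : Type) (f : T -> U) (A : set T) :
  countable A -> countable (f @` A).
Proof. exact: sub_countable (card_image_le _ _). Qed.

Lemma subset_countable (T : Type) (A B : set T) :
  A `<=` B -> countable B -> countable A.
Proof. by move=> AB; exact: sub_countable (subset_card_le AB). Qed.

Lemma countableU (T : Type) (A B : set T) :
  countable A -> countable B -> countable (A `|` B).
Proof.
move=> cA cB; rewrite -bigcup2E; apply: bigcup_countable => // -[|[|i]] _ //=.
Qed.

Lemma finite_set_eventually (A : set nat) :
  finite_set A -> \forall n \near \oo, ~ A n.
Proof.
move=> fA; suff : \forall n \near \oo, forall k, A k -> (k < n)%N.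
  by apply: filterS => n An /An; rewrite ltnn.
by apply: filter_finite_forall => // k _; exact: nbhs_infty_gt.
Qed.

Lemma infinite_set_eventually (A : set nat) (P : nat -> Prop) :
  infinite_set A -> (\forall n \near \oo, P n) -> exists2 n, A n & P n.
Proof.
move=> infA [N _ PN]; apply: contrapT => AP; apply: infA.
apply: sub_finite_set (finite_II N) => n An /=; rewrite ltnNge.
by apply/negP => Nn; apply: AP; exists n => //; exact: PN.
Qed.

End FiniteCountable.

(** * The space C *)

Section CantorLayers.

Definition agree_below (m : nat) (x y : cantor_space) :=
  forall i, (i < m)%N -> x i = y i.

Lemma nbhs_cantor (x : cantor_space) (A : set cantor_space) :
  nbhs x A -> exists m, forall y, agree_below m y x -> A y.
Proof.
pose F : set_system cantor_space :=
  filter_from [set: nat] (fun m => [set y | agree_below m y x]).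
have FF : Filter F.
  apply: filter_fromT_filter; first by exists 0%N.
  move=> i j; exists (maxn i j) => y xy; split=> k kj; apply: xy;
  by rewrite leq_max kj ?orbT.
suff : F --> x by move=> /[apply] -[m _ mA]; exists m.
apply/cvg_sup => i U [V [[B oB <-] /= Bx VU]].
exists i.+1 => // y /(_ i (ltnSn i)) yi; apply: VU => /=.
by rewrite yi.
Qed.

Lemma nbhs_coord (i : nat) (x : cantor_space) : \forall y \near x, y i = x i.
Proof.
exact: (@proj_continuous nat (fun=> bool) i x _ (discrete_set1 (x i))).
Qed.

Definition near_to (m : nat) (c c' : Cset) :=
  c'.1 = c.1 /\ agree_below m c'.2 c.2.

Lemma nbhs_near_to c (A : set Cset) :
  nbhs c A -> exists m, forall c', near_to m c c' -> A c'.
Proof.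
move=> [[P Q] [/= nP nQ] PQA]; have [m mQ] := nbhs_cantor nQ.
exists m => -[n' y] [/= nE yc]; apply: PQA; split => /=; last exact: mQ.
by rewrite nE; exact: nbhs_singleton.
Qed.

Lemma open_CsetP (U : set Cset) :
  open U <-> forall c, U c -> exists m, forall c', near_to m c c' -> U c'.
Proof.
rewrite openE; split=> [oU c Uc|HU c /HU [m mU]].
  exact: nbhs_near_to (oU c Uc).
exists ([set n | n = c.1], [set y | agree_below m y c.2]) => /=.
  split; first exact: discrete_set1.
  apply: (@filter_finite_forall _ _ (nbhs c.2) `I_m
    (fun i (y : cantor_space) => y i = c.2 i)) => // i _.
  exact: nbhs_coord.
by case=> n y /= [nE yc]; apply: mU.
Qed.

Lemma clopen_CsetP (U : set Cset) :
  (forall c, exists m, forall c', near_to m c c' -> (U c' <-> U c)) -> clopen U.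
Proof.
move=> HU; split; first by apply/open_CsetP => c Uc;
  have [m mU] := HU c; exists m => c' /mU ->.
rewrite -openC; apply/open_CsetP => c Uc.
by have [m mU] := HU c; exists m => c' /mU cc' /cc'.
Qed.

Lemma clopen_Cn n : clopen (Cn n).
Proof. by apply: clopen_CsetP => c; exists 0%N => c' [nE _]; rewrite /Cn /= nE. Qed.

(* The code records which basic clopen sets meet [e n], that is, the closure
   of [e n]; there are only continuum many codes, although [Efun] is larger. *)
Definition layer_code (e : Efun) : cantor_space := fun k =>
  `[< if @unpickle (nat * seq bool)%type k is Some p then
        exists2 c, e p.1 c & forall i, (i < size p.2)%N -> c.2 i = nth false p.2 i
      else False >].

(** Every neighbourhood of a point of [e n] contains a cylinder in layer [n], and equal codes mean
    that the same cylinders are met. *)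
Lemma layer_code_closure (e e' : Efun) : (forall n, e n `<=` Cn n) ->
    (forall n, e' n `<=` Cn n) -> layer_code e = layer_code e' ->
  forall n, e n `<=` closure (e' n).
Proof.
move=> eC e'C ee' n c enc B; rewrite nbhsE => -[U [oU Uc] UB].
have [m mU] := (open_CsetP U).1 oU c Uc.
have : layer_code e (pickle (n, mkseq c.2 m)).
  apply/asboolP; rewrite pickleK /=; exists c => // i.
  by rewrite size_mkseq => im; rewrite nth_mkseq.
rewrite ee' => /asboolP; rewrite pickleK /= => -[c' e'c' c'c].
exists c'; split=> //; apply: UB; apply: mU; split.
  by rewrite (e'C _ _ e'c') (eC _ _ enc).
by move=> i im; rewrite c'c ?size_mkseq // nth_mkseq.
Qed.

End CantorLayers.

(** * Almost inclusion *)

Section AlmostInclusion.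
Implicit Types e o : Efun.

Definition ae_sub e o := \forall n \near \oo, e n `<=` o n.

Definition ae_disj e o := \forall n \near \oo, e n `&` o n = set0.

(** Weaker than [inO]: the domain may be finite or empty, which admits [single_layer k] and
    complements. *)
Definition layered o := forall n, clopen (o n) /\ o n `<=` Cn n.

Definition rel_compl o : Efun := fun n => Cn n `\` o n.

Lemma ae_sub_trans e1 e2 e3 : ae_sub e1 e2 -> ae_sub e2 e3 -> ae_sub e1 e3.
Proof. by move=> s12 s23; apply: filterS2 s12 s23 => n; exact: subset_trans. Qed.

Lemma subset_ae e o : (forall n, e n `<=` o n) -> ae_sub e o.
Proof. by move=> eo; apply: nearW. Qed.

Lemma dom_notin e n : ~ dom e n -> e n = set0.
Proof. by move=> /set0P/negP/negPn/eqP. Qed.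

Lemma sqsub_subset e o : sqsub e o -> forall n, e n `<=` o n.
Proof.
move=> [_ eo] n; have [/eo //|/dom_notin ->] := pselect (dom e n).
exact: sub0set.
Qed.

Lemma sqsub_star_ae e o : sqsub_star e o -> ae_sub e o.
Proof.
move=> [_ /finite_set_eventually]; apply: filterS => n neo.
have [dn|/dom_notin ->] := pselect (dom e n); last exact: sub0set.
by apply: contrapT => eo; apply: neo.
Qed.

Lemma perp_ae e o : perp e o -> ae_disj e o.
Proof.
move=> /finite_set_eventually; apply: filterS => n neo.
apply/seteqP; split=> // c [ec oc]; apply: neo.
by split; [exists c | split; [exists c | exists c]].
Qed.

Lemma ae_disjN e o : infinite_set (dom e) -> ae_disj e o -> ~ ae_sub e o.
Proof.
move=> infe deo seo.
have [n [c ec] [eo0 eo]] := infinite_set_eventually infe (filterI deo seo).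
suff : (e n `&` o n) c by rewrite eo0.
by split=> //; exact: eo.
Qed.

Lemma inO_layered o : inO o -> layered o.
Proof.
move=> [[_ oC] ocl] n; split=> //.
have [dn|/dom_notin ->] := pselect (dom o n); last exact: clopen0.
have [[U [oU UE]] [F [cF FE]]] := ocl n dn; have [oCn cCn] := clopen_Cn n.
by split; [rewrite UE; exact: openI | rewrite FE; exact: closedI].
Qed.

Lemma layered_inO o : infinite_set (dom o) -> layered o -> inO o.
Proof.
move=> info lo; split; first by split=> // n; case: (lo n).
move=> n _; have [[oo co] oC] := lo n.
by split; exists (o n); split=> //; rewrite setIidl.
Qed.

Lemma layered_compl o : layered o -> layered (rel_compl o).
Proof.
move=> lo n; split; last exact: subDsetl.
rewrite /rel_compl setDE; apply: clopenI; first exact: clopen_Cn.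
exact: (clopenC set0 (lo n).1).
Qed.

Lemma layered_clopen o : layered o -> clopen [set c | o c.1 c].
Proof.
move=> lo; apply: clopen_CsetP => c.
have [[/open_CsetP oU /closed_openC/open_CsetP oUC] _] := lo c.1.
have [oc|oc] := pselect (o c.1 c).
  have [m mU] := oU _ oc; exists m => c' cc' /=; rewrite (cc'.1).
  by split=> // _; exact: mU.
have [m mU] := oUC _ oc; exists m => c' cc' /=; rewrite (cc'.1).
by split=> // /(mU _ cc').
Qed.

End AlmostInclusion.

Lemma countable_range (U : Type) (A : set U) : A !=set0 -> countable A ->
  exists f : nat -> U, range f = A.
Proof.
move=> [a Aa] /countable_injP [r rinj].
have /choice [f fP] : forall i, exists x, A x /\ forall y, A y -> r y = i -> x = y.
  move=> i; have [[x [Ax rx]]|nx] := pselect (exists x, A x /\ r x = i).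
    by exists x; split=> // y Ay ry; apply: rinj; rewrite ?inE // rx ry.
  by exists a; split=> // y Ay ry; case: nx; exists y.
exists f; apply/seteqP; split=> [_ [i _ <-]|y Ay]; first by case: (fP i).
by exists (r y) => //; have [_] := fP (r y); apply.
Qed.

(** * Positive sequences of layers *)

Section Positive.
Variable H : set Efun.
Hypothesis HE : H `<=` inE_.
Implicit Types e o h : Efun.

Definition positive e := exists2 h, H h & ae_sub h e.

Definition decides e o := ae_sub e o \/ ae_disj e o.

Lemma positive_sub e e' : ae_sub e e' -> positive e -> positive e'.
Proof. by move=> ee' [h Hh he]; exists h => //; exact: ae_sub_trans he ee'. Qed.

Lemma positive_mem h : H h -> positive h.
Proof. by move=> Hh; exists h => //; apply: subset_ae => n. Qed.

Lemma positive_inhabited e : positive e -> exists n c, e n c.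
Proof.
move=> [h Hh he]; have [infh _] := HE Hh.
by have [n [c hc] hen] := infinite_set_eventually infh he; exists n, c; exact: hen.
Qed.

(** A member of [H] almost inside [edot e o] would be both almost inside [o] and almost disjoint
    from it. This is how points are kept out of new clopen sets. *)
Lemma positive_diff_ae_sub e o : positive (edot e o) -> ~ ae_sub e o.
Proof.
move=> [h Hh he] eo; apply: (@ae_disjN h o); first by case: (HE Hh).
  apply: filterS he => n hen; apply/seteqP; split=> // c [/hen [_ no] /no//].
apply: filterS2 he eo => n hen eon c /hen [/eon].
by [].
Qed.

Lemma positive_diff_disj e e' o : positive e' -> ae_sub e' e -> ae_disj e' o ->
  positive (edot e o).
Proof.
move=> pe' ee' e'o; apply: positive_sub pe'.
apply: filterS2 ee' e'o => n een e'on c e'c; split; first exact: een.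
by move=> oc; suff : set0 c by []; rewrite -e'on.
Qed.

(** Largeness is applied to one member of [H] chosen almost below each [e] in [P]; what remains of
    that member is almost below [edot e o]. *)
Lemma large_positive (G : set Efun) g (P : set Efun) : large G H -> G g ->
    countable P -> P `<=` positive ->
  exists o, [/\ layered o, forall n, g n `<=` o n &
                forall e, P e -> positive (edot e o)].
Proof.
move=> Hlarge Gg cP Ppos.
have /choice [k kP] : forall e, exists h, P e -> H h /\ ae_sub h e.
  move=> e; have [/Ppos [h Hh he]|] := pselect (P e); first by exists h.
  by exists e.
have subH : k @` P `<=` H by move=> _ [e Pe <-]; have [] := kP e Pe.
have [u [uO [gu uP]]] := Hlarge g Gg _ (countable_image k cP) subH.
exists u; split; [exact: inO_layered | exact: sqsub_subset |].
move=> e Pe; have [_ kee] := kP e Pe; exists (edot (k e) u).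
  by apply: uP; exists e.
by apply: filterS kee => n keen c [/keen].
Qed.

Lemma shrink_decides h (O : set Efun) : shrinkable H -> H h -> countable O ->
    O `<=` layered ->
  exists h', [/\ H h', forall n, h' n `<=` h n & forall o, O o -> decides h' o].
Proof.
move=> Hshr Hh cO Ol.
(* Shrinkability speaks only of infinite domains; a sequence with finite domain is almost disjoint
   from everything. *)
pose O' := O `&` [set o | infinite_set (dom o)].
have cO' : countable O' by apply: subset_countable cO => o [].
have O'O : O' `<=` inO by move=> o [/Ol lo info]; exact: layered_inO.
have [h' Hh' [h'h h'O]] := Hshr h Hh O' cO' O'O; exists h'; split=> //.
  exact: sqsub_subset.
move=> o Oo; have [fino|info] := pselect (finite_set (dom o)).
  right; apply: filterS (finite_set_eventually fino) => n /dom_notin ->.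
  by rewrite setI0.
have [/sqsub_star_ae|/perp_ae] := h'O o (conj Oo info); by [left|right].
Qed.

(** Cylinders shrinking to [y]: from layer [i.+1] on the coordinate [i] is [y i], so a member of [H]
    below decides all half-spaces as [y] does. *)
Definition branch (y : cantor_space) : Efun :=
  fun n => [set c | c.1 = n /\ agree_below n c.2 y].

Lemma layered_branch y : layered (branch y).
Proof.
move=> n; split; last by move=> c [].
apply: clopen_CsetP => c; exists n => c' [c1 c2]; rewrite /branch /= c1.
by split=> -[-> cy]; split=> // i iN; rewrite -cy ?c2.
Qed.

Lemma inO_branch y : inO (branch y).
Proof.
apply: layered_inO (layered_branch y).
rewrite (_ : dom _ = setT); first exact: infinite_nat.
by apply/seteqP; split=> // n _; exists (n, y).
Qed.

(** Diagonal argument: layer [n] of [u] omits only those of the first [n] sets of [T] that miss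
    [s n]. Finitely many removals keep the layer clopen, and each set of [T] is removed from almost
    all layers. *)
Lemma exists_separating_open s (T : set Efun) : H s -> countable T ->
    T `<=` layered -> (forall t, T t -> ae_disj s t) ->
  exists u, [/\ layered u, forall n, s n `<=` u n &
                forall t, T t -> ae_disj u t].
Proof.
move=> Hs cT Tl Ts.
have [sE sC] := HE Hs.
have [T0|/set0P T0] := eqVneq T set0.
  exists Cn; split=> [n||t]; [by split=> //; exact: clopen_Cn|exact: sC|].
  by rewrite T0.
have [f fT] := countable_range T0 cT.
have fl i : layered (f i) by apply: Tl; rewrite -fT; exists i.
pose u n := Cn n `\` \bigcup_(i in [set i | (i < n)%N /\ s n `&` f i n = set0]) f i n.
exists u; split.
- move=> n; split; last exact: subDsetl.
  rewrite /u setDE; apply: clopenI; first exact: clopen_Cn.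
  apply: (clopenC set0); split.
    by apply: bigcup_open => i _; have [[]] := fl i n.
  apply: closed_bigcup => [|i _]; last by have [[]] := fl i n.
  by apply: sub_finite_set (finite_II n) => i [].
- move=> n c sc; split; first exact: sC.
  by move=> [i [_ sf] fc]; suff : set0 c by []; rewrite -sf.
move=> t; rewrite -fT => -[i _ <-].
have : ae_disj s (f i) by apply: Ts; rewrite -fT; exists i.
move=> sf; apply: filterS2 sf (nbhs_infty_gt i) => n sfn iN.
apply/seteqP; split=> // c [[_ nfc] fc]; apply: nfc; exists i => //.
Qed.

End Positive.

(** * Recursion and bookkeeping along omega_1 *)

Definition update (W D : Type) (f : W -> D) (a : W) (d : D) : W -> D :=
  fun b => if pselect (b = a) then d else f b.

Lemma update_eq (W D : Type) (f : W -> D) a d : update f a d a = d.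
Proof. by rewrite /update; case: pselect. Qed.

Lemma update_neq (W D : Type) (f : W -> D) a d b : b <> a -> update f a d b = f b.
Proof. by rewrite /update; case: pselect. Qed.

Section WellOrder.
Variables (W : Type) (lt : W -> W -> Prop).
Hypothesis omega1W : is_omega1 lt.

Definition wle x y := x = y \/ lt x y.

Lemma wlt_irr x : ~ lt x x. Proof. by case: omega1W. Qed.

Lemma wlt_trans y x z : lt x y -> lt y z -> lt x z.
Proof. by case: omega1W => _ [+ _]; apply. Qed.

Lemma wle_lt_trans y x z : wle x y -> lt y z -> lt x z.
Proof. by move=> [->//|]; exact: wlt_trans. Qed.

Lemma wle_trans y x z : wle x y -> wle y z -> wle x z.
Proof. by move=> xy [<-//|yz]; right; exact: wle_lt_trans xy yz. Qed.

Lemma wltNge x y : ~ lt x y -> wle y x.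
Proof.
have [_ [_ [/(_ x y) + _]]] := omega1W.
by move=> [xy /(_ xy)|[->|yx]] // _; [left|right].
Qed.

Lemma wle_total x y : wle x y \/ wle y x.
Proof. by have [xy|/wltNge yx] := pselect (lt x y); [left; right|right]. Qed.

Lemma wlt_neq x y : lt x y -> x <> y.
Proof. by move=> xy xyE; move: xy; rewrite xyE; exact: wlt_irr. Qed.

Lemma countable_wlt x : countable [set y | lt y x].
Proof. by case: omega1W => _ [_ [_ [_ [+ _]]]]; apply. Qed.

Lemma uncountable_W : ~ countable [set: W].
Proof. by case: omega1W => _ [_ [_ [_ [_ ]]]]. Qed.

(** As [P a f] looks at [f] only up to [a], values fixed later cannot destroy it. *)
Lemma transfinite_choice (D : Type) (d0 : D) (P : W -> (W -> D) -> Prop) :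
    (forall a f f', (forall b, wle b a -> f b = f' b) -> P a f -> P a f') ->
    (forall a f, (forall b, lt b a -> P b f) -> exists d, P a (update f a d)) ->
  exists f, forall a, P a f.
Proof.
move=> Ploc Pstep.
have wf : well_founded lt by case: omega1W => _ [_ [_ []]].
(* A value is supplied for every pair, [d0] serving when the earlier stages fail [P]; the final
   induction shows that they never do. *)
have /choice [nxt nxtP] : forall p : W * (W -> D), exists d,
    (forall b, lt b p.1 -> P b p.2) -> P p.1 (update p.2 p.1 d).
  move=> [a f] /=; have [/Pstep [d dP]|nP] := pselect (forall b, lt b a -> P b f).
    by exists d.
  by exists d0.
pose restr a (r : forall b, lt b a -> D) b :=
  match pselect (lt b a) with left ba => r b ba | right _ => d0 end.
pose f := Fix wf (fun=> D) (fun a r => nxt (a, restr a r)).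
have fE a : f a = nxt (a, restr a (fun b _ => f b)).
  rewrite /f Fix_eq // => x r r' rr'; congr (nxt (_, _)).
  by apply/funext => b; rewrite /restr; case: pselect.
exists f; apply: (well_founded_ind wf) => a IH.
pose g := restr a (fun b _ => f b).
have gE b : lt b a -> g b = f b by rewrite /g /restr; case: pselect.
have /= := nxtP (a, g); rewrite -(fE a) => Pg.
have {}Pg : P a (update g a (f a)).
  apply: Pg => b ba; apply: (Ploc b f) => [c cb|]; last exact: IH.
  by rewrite gE //; exact: wle_lt_trans cb ba.
apply: (Ploc _ _ _ _ Pg) => b [->|ba]; first by rewrite update_eq.
by rewrite update_neq ?gE //; exact: wlt_neq.
Qed.

(** * Bookkeeping of pairs of codes under CH *)

Section Continuum.
Variable phi : W -> cantor_space.
Hypothesis phi_bij : bijective phi.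

Lemma uncountable_cantor : ~ countable [set: cantor_space].
Proof.
have [psi phiK psiK] := phi_bij; move=> cC; apply: uncountable_W.
apply: subset_countable (countable_image psi cC) => w _.
by exists (phi w).
Qed.

Definition even_bits (y : cantor_space) : cantor_space := fun n => y n.*2.
Definition odd_bits (y : cantor_space) : cantor_space := fun n => y n.*2.+1.

Definition interleave (y z : cantor_space) : cantor_space :=
  fun n => if odd n then z n./2 else y n./2.

Lemma even_interleave y z : even_bits (interleave y z) = y.
Proof.
by apply/funext => n; rewrite /even_bits /interleave odd_double doubleK.
Qed.

Lemma odd_interleave y z : odd_bits (interleave y z) = z.
Proof.
by apply/funext => n; rewrite /odd_bits /interleave /= odd_double /= uphalf_double.
Qed.

Lemma even_bits_onto y : exists w, even_bits (phi w) = y.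
Proof.
have [psi phiK psiK] := phi_bij; exists (psi (interleave y y)).
by rewrite psiK even_interleave.
Qed.

(** With the even bits free, [z] is the odd half of uncountably many reals, while only countably
    many ordinals precede [x]. *)
Lemma odd_bits_cofinal z x : exists2 w, wle x w & odd_bits (phi w) = z.
Proof.
have [psi phiK psiK] := phi_bij; apply: contrapT => nz.
apply: uncountable_cantor.
apply: subset_countable (countable_image (even_bits \o phi) (countable_wlt x)).
move=> y _; exists (psi (interleave y z)); last by rewrite /= psiK even_interleave.
apply: contrapT => /wltNge xw; apply: nz; exists (psi (interleave y z)) => //.
by rewrite psiK odd_interleave.
Qed.

End Continuum.
End WellOrder.

(** * The stages of the construction *)

Section Stages.
Variables (W : Type) (lt : W -> W -> Prop).
Hypothesis omega1W : is_omega1 lt.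
Variables (G H : set Efun).
Hypotheses (GE : G `<=` inE_) (HE : H `<=` inE_).
Hypotheses (Hdense : denseE H) (Hshr : shrinkable H) (Hlarge : large G H).
(* [hcode a] and [gcode a] are the codes of the members of [H] and [G] treated
   at stage [a]. *)
Variables hcode gcode : W -> cantor_space.

Local Notation wle := (wle lt).

(* Stage [a] creates the point [a], whose trace on the earlier clopen sets is
   decided by [seed]; it makes [att] accumulate at the point [pt]; and it adds two
   clopen sets avoiding all earlier points: [lu], which contains [a], and [lv],
   which does not and which covers a member of [G] (if some member has the code
   [gcode a]; otherwise [lv] is empty). *)
Record stage := Stage
  { seed : Efun; att : Efun; pt : W; lu : Efun; lv : Efun }.

Definition clopen_index : Type := ((nat + nat) + (W * bool))%type.

Definition single_layer k : Efun := fun n => [set c | c.1 = n /\ n = k].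
Definition half i : Efun := fun n => [set c | c.1 = n /\ c.2 i = true].

Implicit Types (f : W -> stage) (a b g : W) (j : clopen_index).

Definition trace f j : Efun :=
  match j with
  | inl (inl k) => single_layer k
  | inl (inr i) => half i
  | inr (b, true) => lu (f b)
  | inr (b, false) => lv (f b)
  end.

(* The point [g] belongs to the [j]-th subbasic clopen set iff [member f g j]. *)
Definition member f g j := ae_sub (seed (f g)) (trace f j).

(** The part of [h] in the Boolean cell of the point [g]; its positivity for all finite [F] puts [g]
    in the closure of [Rg h]. *)
Definition cell f h g (F : set clopen_index) : Efun :=
  fun n => [set c | h n c /\ forall j, F j -> (trace f j n c <-> member f g j)].

Definition indices_over (B : set W) : set clopen_index :=
  [set j | if j is inr p then B p.1 else True].

Definition below a := indices_over [set b | lt b a].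

Definition upto a := indices_over [set b | wle b a].

(** The pairs [(h, g)] for which stage [b] promises that [h] accumulates at [g]. *)
Definition attached f b h g :=
  (h = seed (f b) /\ g = b) \/ (h = att (f b) /\ g = pt (f b)).

(** The invariant proper is [good_cell]: the promises of all stages up to [a] survive the sets added
    at [a]. [good_att] and [good_cover] treat all members with one code at once. *)
Record good a f : Prop := Good {
  good_lu : layered (lu (f a));
  good_lv : layered (lv (f a));
  good_seed : H (seed (f a));
  good_att_in : H (att (f a));
  good_pt : wle (pt (f a)) a;
  good_att : forall h, H h -> layer_code h = hcode a ->
    forall n, att (f a) n `<=` closure (h n);
  good_cover : forall k, G k -> layer_code k = gcode a ->
    forall n, k n `<=` lv (f a) n;
  good_member : member f a (inr (a, true));
  good_avoid : forall g, lt g a -> ~ member f g (inr (a, true));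
  good_avoidv : forall g, wle g a -> ~ member f g (inr (a, false));
  good_cell : forall b h g F, wle b a -> attached f b h g -> wle g a ->
    finite_set F -> F `<=` upto a -> positive H (cell f h g F)
}.

Lemma upto_subset a b : wle a b -> upto a `<=` upto b.
Proof. by move=> ab [//|p] pa; exact: (wle_trans omega1W) pa ab. Qed.

Lemma finite_upto b F : finite_set F -> exists2 a, wle b a & F `<=` upto a.
Proof.
move=> finF; apply: (@finite_directed _ _ [set a | wle b a] upto) => //.
- by exists b; left.
- move=> i j bi bj; have [ij|ji] := wle_total omega1W i j.
    by exists j => // k [/(upto_subset ij)|].
  by exists i => // k [|/(upto_subset ji)].
- move=> [i|p] _; first by exists b => //; left.
  have [bp|pb] := wle_total omega1W b p.1; first by exists p.1 => //; left.
  by exists b => //; left.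
Qed.

Lemma good_local a f f' : (forall b, wle b a -> f b = f' b) ->
  good a f -> good a f'.
Proof.
move=> ff' [glu glv gs gs' gp ga gc gm gav gavv gcell].
have fa := ff' a (or_introl erefl).
have tE j : upto a j -> trace f j = trace f' j.
  by case: j => [[k|i]|[b []]] //= ba; rewrite ff'.
have mE g j : wle g a -> upto a j -> member f g j = member f' g j.
  by move=> ga' ja; rewrite /member ff' // tE.
have ua e : upto a (inr (a, e)) by left.
split; rewrite -?fa //.
- by rewrite -mE //; left.
- by move=> g ga'; rewrite -mE //; [exact: gav|right].
- by move=> g ga'; rewrite -mE //; exact: gavv.
move=> b h g F ba; rewrite /attached -ff' // => bhg ga' finF Fa.
rewrite (_ : cell f' h g F = cell f h g F); first exact: gcell bhg _ _ _.
apply/funext => n; apply/seteqP; split=> c [hc cF]; split=> // j Fj;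
  have := cF j Fj; rewrite tE ?mE //; exact: Fa.
Qed.

Lemma layered_single k : layered (single_layer k).
Proof.
move=> n; split; last by move=> c [].
by apply: clopen_CsetP => c; exists 0%N => c' [c1 _]; rewrite /single_layer /= c1.
Qed.

Lemma layered_half i : layered (half i).
Proof.
move=> n; split; last by move=> c [].
apply: clopen_CsetP => c; exists i.+1 => c' [c1 c2].
by rewrite /half /= c1 c2.
Qed.

Lemma countable_indices_over (B : set W) :
  countable B -> countable (indices_over B).
Proof.
move=> cB.
pose A := inl @` [set: (nat + nat)%type] `|`
  inr @` (B `*` [set: bool]) : set clopen_index.
apply: (@subset_countable _ _ A).
  by move=> [i|[b e]] ja; [left; exists i|right; exists (b, e)].
by apply: countableU; apply: countable_image => //; exact: countableX.
Qed.

Lemma countable_below a : countable (below a).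
Proof. exact/countable_indices_over/(countable_wlt omega1W). Qed.

Lemma ae_sub_cell f h g F e : finite_set F -> ae_sub e h ->
    (forall j, F j -> \forall n \near \oo, forall c, e n c ->
       (trace f j n c <-> member f g j)) ->
  ae_sub e (cell f h g F).
Proof.
move=> finF eh /(filter_finite_forall _ finF) eF.
apply: filterS2 eh eF => n ehn eFn c ec; split; first exact: ehn.
by move=> j Fj; exact: eFn.
Qed.

Lemma decides_trace_iff e o : inE_ e -> decides e o ->
  \forall n \near \oo, forall c, e n c -> (o n c <-> ae_sub e o).
Proof.
move=> [infe _] [eo|eo].
  by apply: (filterS _ eo) => n eon c ec; split=> // _; exact: eon.
have neo := ae_disjN infe eo; apply: filterS eo => n eon c ec; split=> // oc.
by suff : set0 c by []; rewrite -eon.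
Qed.

(** * One stage, given the earlier ones *)

Section Step.
Variables (a : W) (f : W -> stage).
Hypothesis good_f : forall b, lt b a -> good b f.

Lemma layered_trace j : below a j -> layered (trace f j).
Proof.
case: j => [[k|i]|[b []]] /= ja; [exact: layered_single|exact: layered_half| |].
- exact: good_lu (good_f ja).
- exact: good_lv (good_f ja).
Qed.

(** There may be no last stage before [a], but the finite set [F] is reached at some [d] before [a],
    and the invariant of [d] applies. *)
Lemma positive_cell b h g F : lt b a -> attached f b h g -> finite_set F ->
  F `<=` below a -> lt g a /\ positive H (cell f h g F).
Proof.
move=> ba bhg finF Fa.
have gb : wle g b.
  by case: bhg => -[_ ->]; [left|exact: good_pt (good_f ba)].
split; first exact: (wle_lt_trans omega1W) gb ba.
have [|||d [da bd] Fd] := @finite_directed _ _ [set d | lt d a /\ wle b d] upto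
  _ _ _ finF.
- by exists b; split=> //; left.
- move=> i j [ia bi] [ja bj].
  have [ij|ji] := wle_total omega1W i j.
    by exists j => // k [/(upto_subset ij)|].
  by exists i => // k [|/(upto_subset ji)].
- move=> [i|p] /Fa ja; first by exists b => //; split=> //; left.
  have [bp|pb] := wle_total omega1W b p.1; first by exists p.1 => //; left.
  by exists b => //; split=> //; left.
apply: (good_cell (good_f da) bd bhg) => //.
exact: (wle_trans omega1W) gb bd.
Qed.

Lemma shrink_below h : H h -> exists h', [/\ H h', forall n, h' n `<=` h n &
  forall j, below a j -> decides h' (trace f j)].
Proof.
move=> Hh.
have [|h' [Hh' h'h h'O]] := shrink_decides Hshr Hh
    (countable_image (trace f) (countable_below a)).
  by move=> _ [j ja <-]; exact: layered_trace.
by exists h'; split=> // j ja; apply: h'O; exists j.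
Qed.

Definition same_trace h g :=
  forall j, below a j -> (member f g j <-> ae_sub h (trace f j)).

(** The countably many old points determine countably many branches. A member of [H] below another
    branch [y] differs from each old point on some half-space. *)
Lemma exists_new_trace (phi : W -> cantor_space) : bijective phi ->
  exists s, [/\ H s, forall j, below a j -> decides s (trace f j) &
                forall g, lt g a -> ~ same_trace s g].
Proof.
move=> phi_bij.
pose tr g : cantor_space := fun i => `[< member f g (inl (inr i)) >].
have [y yP] : exists y, forall g, lt g a -> tr g <> y.
  apply: contrapT => ny; apply: (uncountable_cantor omega1W phi_bij).
  apply: subset_countable (countable_image tr (countable_wlt omega1W a)) => y _.
  apply: contrapT => nyr; apply: ny; exists y => g ga gy; apply: nyr.
  by exists g.
have [h Hh /sqsub_subset hy] := Hdense (inO_branch y).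
have [s [Hs sh sdec]] := shrink_below Hh; exists s; split=> // g ga sg.
apply: (yP g ga); apply/funext => i; rewrite /tr.
have -> : member f g (inl (inr i)) = ae_sub s (half i).
  by apply/propext; apply: sg.
have sy : \forall n \near \oo, forall c, s n c -> c.1 = n /\ c.2 i = y i.
  by apply: filterS (nbhs_infty_gt i) => n ni c /sh/hy [-> ->].
case yi: (y i) in sy *.
  by apply/asboolP; apply: filterS sy.
apply/asboolP; apply: ae_disjN; first by case: (HE Hs).
apply: filterS sy => n syn; apply/seteqP; split=> // c [/syn [_ ci] [_]].
by rewrite ci.
Qed.

Lemma exists_seed (phi : W -> cantor_space) : bijective phi ->
  exists s e w, [/\ H s, forall j, below a j -> decides s (trace f j),
    forall g, lt g a -> ~ same_trace s g,
    forall h, H h -> layer_code h = hcode a -> forall n, e n `<=` closure (h n) &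
    (w = a /\ e = s) \/ [/\ lt w a, H e, forall j, below a j ->
       decides e (trace f j) & same_trace e w]].
Proof.
move=> phi_bij.
(* If no member has the code [hcode a], the requirement is void and any member of [H] will do. *)
have [h0 Hh0 h0P] : exists2 h0, H h0 & forall h, H h ->
    layer_code h = hcode a -> forall n, h0 n `<=` closure (h n).
  have [[h [Hh ha]]|nh] := pselect (exists h, H h /\ layer_code h = hcode a).
    exists h => // h' Hh' h'a; apply: layer_code_closure; last by rewrite ha.
      by case: (HE Hh).
    by case: (HE Hh').
  have [h Hh _] := Hdense (inO_branch point); exists h => // h' Hh' h'a.
  by case: nh; exists h'.
have [e [He eh0 edec]] := shrink_below Hh0.
have eP h : H h -> layer_code h = hcode a -> forall n, e n `<=` closure (h n).
  by move=> Hh ha n; exact: subset_trans (eh0 n) (h0P h Hh ha n).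
have [[g [ga eg]]|neg] := pselect (exists g, lt g a /\ same_trace e g).
  have [s [Hs sdec sg]] := exists_new_trace phi_bij.
  by exists s, e, g; split=> //; right.
exists e, e, a; split=> //; last by left.
by move=> g ga eg; apply: neg; exists g.
Qed.

(** Largeness covers one member [k] with the code; the layers of [v] being closed, [v] then covers
    all members with that code. *)
Lemma exists_lv (P : set Efun) : countable P -> P `<=` positive H ->
  exists v, [/\ layered v, forall k, G k -> layer_code k = gcode a ->
                  forall n, k n `<=` v n &
                forall e, P e -> positive H (edot e v)].
Proof.
move=> cP Ppos.
have [[k [Gk ka]]|nk] := pselect (exists k, G k /\ layer_code k = gcode a).
  have [v [lv_ kv vP]] := large_positive Hlarge Gk cP Ppos.
  exists v; split=> // k' Gk' k'a n.
  have kk' : k' n `<=` closure (k n).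
    apply: layer_code_closure; rewrite ?k'a //; first by case: (GE Gk').
    by case: (GE Gk).
  have [[_ cv] _] := lv_ n.
  apply: subset_trans kk' _; rewrite closureE => c; apply.
  by split=> //; exact: kv.
exists (fun=> set0); split=> [n|k Gk ka|e /Ppos]; first by split=> //; exact: clopen0.
  by case: nk; exists k.
by apply: positive_sub; apply: subset_ae => n c ec; split.
Qed.

(** The type of [s] differs from that of an old point [g] at some index [j], and [u] almost misses
    the side of [trace f j] on which [g] lies. The cell refined by [j] is still positive and almost
    disjoint from [u]. *)
Lemma exists_lu (K : set (Efun * W)) s : H s ->
    (forall j, below a j -> decides s (trace f j)) ->
    (forall g, lt g a -> ~ same_trace s g) ->
    (forall p F, K p -> finite_set F -> F `<=` below a ->
       lt p.2 a /\ positive H (cell f p.1 p.2 F)) ->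
  exists u, [/\ layered u, forall n, s n `<=` u n &
    forall p F, K p -> finite_set F -> F `<=` below a ->
      positive H (edot (cell f p.1 p.2 F) u)].
Proof.
move=> Hs sdec snew Kpos.
(* The side of [trace f j] that [s] almost avoids. *)
pose sep j := if pselect (ae_sub s (trace f j)) then rel_compl (trace f j)
              else trace f j.
have [||u [lu_ su uT]] := exists_separating_open HE Hs
    (countable_image sep (countable_below a)).
- move=> _ [j ja <-]; have lj := layered_trace ja; rewrite /sep.
  by case: pselect => //= _; exact: layered_compl.
- move=> _ [j ja <-]; rewrite /sep; case: pselect => sj /=.
    apply: (filterS _ sj) => n sjn; apply/seteqP; split=> // c [/sjn jc [_ njc]].
    exact: njc.
  by case: (sdec j ja).
exists u; split=> // -[h g] F Khg finF Fa /=.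
have [ga _] := Kpos _ _ Khg finF Fa.
have /existsNP [j /not_implyP [ja gj]] := snew g ga.
have [||_ pos] := Kpos (h, g) (j |` F) Khg.
- by rewrite finite_setU; split=> //; exact: finite_set1.
- by move=> i [->|/Fa].
apply: positive_diff_disj pos _ _.
  by apply: subset_ae => n c [hc cF]; split=> // i Fi; apply: cF; right.
have uj : ae_disj u (sep j) by apply: uT; exists j.
apply: (filterS _ uj) => n ujn; apply/seteqP; split=> // c [[hc cF] uc].
rewrite -ujn; split=> //; have := cF j (or_introl erefl); rewrite /sep.
case: pselect => sj /= cj.
  split; first exact: (lu_ n).2.
  by move=> /cj gj'; apply: gj.
by apply/cj; apply: contrapT => ngj; apply: gj.
Qed.

Lemma good_step (phi : W -> cantor_space) : bijective phi ->
  exists d, good a (update f a d).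
Proof.
move=> phi_bij.
have [s [e [w [Hs sdec snew eP ew]]]] := exists_seed phi_bij.
(* The promises concerning old points. The pair [(e, w)] is among them if [w] is old; otherwise [e]
   is the seed, treated apart. *)
pose K : set (Efun * W) := [set p | (exists2 b, lt b a & attached f b p.1 p.2) \/
  (lt w a /\ p = (e, w))].
have cK : countable K.
  have cA := countable_wlt omega1W a.
  pose A := (fun b => (seed (f b), b)) @` [set b | lt b a] `|`
    (fun b => (att (f b), pt (f b))) @` [set b | lt b a] `|` [set (e, w)].
  apply: (@subset_countable _ _ A).
    move=> [h g] [[b ba [[/= -> ->]|[/= -> ->]]]|[_ ->]]; last by right.
      by left; left; exists b.
    by left; right; exists b.
  apply: countableU; last exact: countable1.
  by apply: countableU; exact: countable_image.
have Kpos p F : K p -> finite_set F -> F `<=` below a ->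
    lt p.2 a /\ positive H (cell f p.1 p.2 F).
  move=> [[b ba att_p]|[wa ->]] finF Fa; first exact: (positive_cell ba).
  case: ew => [[wE _]|[_ He edec ew]].
    by case: (wlt_irr omega1W (x := a)); rewrite wE in wa.
  split=> //=; apply: positive_sub (positive_mem He).
  apply: ae_sub_cell => // [|j /Fa ja]; first by apply: subset_ae => n.
  apply: filterS (decides_trace_iff (HE He) (edec j ja)) => n ejn c ec.
  by rewrite ejn // ew.
have [u [lu_ su uP]] := exists_lu Hs sdec snew Kpos.
(* [v] is chosen after [u], so the cells enter with [u] already removed; [s] enters whole, since it
   must stay inside [u]. *)
pose P := [set s] `|` (fun q : (Efun * W) * set clopen_index =>
    edot (cell f q.1.1 q.1.2 q.2) u) @`
  (K `*` [set F | F `<=` below a /\ finite_set F]).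
have [||v [lv_ vG vP]] := @exists_lv P.
- apply: countableU; first exact: countable1.
  apply: countable_image; apply: countableX => //.
  exact: countable_finite_subset (countable_below a).
- move=> _ [->|[[p F] [/= Kp [Fa finF]] <-]]; first exact: positive_mem.
  exact: uP.
have sv : positive H (edot s v) by apply: vP; left.
have Kuv p F : K p -> finite_set F -> F `<=` below a ->
    positive H (edot (edot (cell f p.1 p.2 F) u) v).
  by move=> Kp finF Fa; apply: vP; right; exists (p, F).
pose d := Stage s e w u v; exists d; set f' := update f a d.
have f'a : f' a = d by rewrite /f' update_eq.
have f'b b : lt b a -> f' b = f b.
  by move=> ba; rewrite /f' update_neq //; exact: (wlt_neq omega1W).
have tE j : below a j -> trace f' j = trace f j.
  by case: j => [[k|i]|[b []]] //= ba; rewrite f'b.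
have mE g j : lt g a -> below a j -> member f' g j = member f g j.
  by move=> ga ja; rewrite /member f'b // tE.
have Kself g : lt g a -> K (seed (f g), g).
  by move=> ga; left; exists g => //; left.
have uavoid g : lt g a -> ~ member f' g (inr (a, true)).
  move=> ga; rewrite /member f'b //= f'a /=; apply: (positive_diff_ae_sub HE).
  apply: positive_sub (uP _ _ (Kself g ga) (@finite_set0 _) (@sub0set _ _)).
  by apply: subset_ae => n c [[sc _] uc].
have vavoid g : wle g a -> ~ member f' g (inr (a, false)).
  move=> [->|ga]; rewrite /member /= f'a /=.
    exact: (positive_diff_ae_sub HE).
  rewrite f'b //; apply: (positive_diff_ae_sub HE).
  apply: positive_sub (Kuv _ _ (Kself g ga) (@finite_set0 _) (@sub0set _ _)).
  by apply: subset_ae => n c [[[sc _] uc] vc].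
have ua : member f' a (inr (a, true)).
  by rewrite /member /= f'a; exact: (subset_ae su).
split; rewrite ?f'a //.
  by rewrite /=; case: ew => [[_ ->]|[_ He _ _]].
  by rewrite /=; case: ew => [[-> _]|[wa _ _ _]]; [left|right].
move=> b h g F ba bhg ga finF Fa.
have : K (h, g) \/ (h = s /\ g = a).
  move: ba bhg => [->|ba]; rewrite /attached.
    rewrite f'a => -[[-> ->]|[/= -> ->]]; first by right.
    by case: ew => [[-> ->]|[wa _ _ _]]; [right|left; right].
  by rewrite f'b // => bhg; left; left; exists b.
have F_cases j : F j -> [\/ below a j, j = inr (a, true) | j = inr (a, false)].
  move=> /Fa; case: j => [i|[c []]] /=; first by constructor 1.
    by move=> [->|ca]; [constructor 2|constructor 1].
  by move=> [->|ca]; [constructor 3|constructor 1].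
move=> [Khg|[-> ->]].
  have finF' : finite_set (F `&` below a) by apply: finite_setIl.
  have [ga' _] := Kpos _ _ Khg finF' (@subIsetr _ _ _).
  (* An old point is in neither new set, so its cell over the earlier indices, minus [u] and [v],
     lies in its cell over [F]. *)
  apply: positive_sub (Kuv _ _ Khg finF' (@subIsetr _ _ _)).
  apply: subset_ae => n c [[[hc cF] uc] vc]; split=> // j Fj.
  case: (F_cases j Fj) => [ja|jE|jE].
  - by rewrite tE // mE //; exact: cF.
  - by rewrite jE /= f'a; split=> // /(uavoid g ga').
  - by rewrite jE /= f'a; split=> // /(vavoid g ga).
(* For the new point, [s] minus [v] is inside [u], outside [v], and decides the earlier traces as
   [s] does. *)
apply: positive_sub sv; apply: ae_sub_cell => //.
  by apply: subset_ae => n c [].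
move=> j Fj; case: (F_cases j Fj) => [ja|->|->].
- rewrite /member tE // f'a /=.
  apply: filterS (decides_trace_iff (HE Hs) (sdec j ja)) => n sjn c [sc _].
  exact: sjn.
- by apply: nearW => n c [/su uc _]; rewrite /= f'a; split.
- have nv := vavoid a (or_introl erefl).
  by apply: nearW => n c [_ vc]; rewrite /= f'a; split.
Qed.

End Step.

Lemma good_stages (phi : W -> cantor_space) : bijective phi ->
  exists f, forall a, good a f.
Proof.
move=> phi_bij.
have [w0 _] : [set: W] !=set0.
  apply/set0P/eqP => W0; apply: (uncountable_W omega1W).
  by rewrite W0; exact: countable0.
pose d0 := Stage (fun=> set0) (fun=> set0) w0 (fun=> set0) (fun=> set0).
apply: (transfinite_choice omega1W d0) => [a f f'|a f fb].
  exact: good_local.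
exact: (good_step fb phi_bij).
Qed.
End Stages.

(** * The topology *)

Section ClopenSubbase.
Variables (X J : Type) (U : J -> set X).
Implicit Types (F : set J) (x y : X).

Definition same_cell F x y := forall j, F j -> (U j y <-> U j x).

Definition clopen_topology : set (set X) :=
  [set V | forall x, V x -> exists2 F, finite_set F & same_cell F x `<=` V].

Lemma open_same_cell F x : finite_set F -> clopen_topology (same_cell F x).
Proof.
move=> finF y xy; exists F => // z yz j Fj.
by rewrite yz //; exact: xy.
Qed.

Lemma clopen_same_cell F x :
  finite_set F -> t_clopen clopen_topology (same_cell F x).
Proof.
move=> finF; split; first exact: open_same_cell.
move=> y nxy; exists F => // z yz xz; apply: nxy => j Fj.
by rewrite -yz //; exact: xz.
Qed.

Lemma clopen_topologyP : t_is_topology clopen_topology.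
Proof.
split; first by []; split; first by move=> x _; exists set0.
split=> [T TU x [V TV Vx]|A B oA oB x [Ax Bx]].
  have [F finF FV] := TU V TV x Vx.
  by exists F => // y /FV Vy; exists V.
have [F finF FA] := oA x Ax; have [F' finF' FB] := oB x Bx.
exists (F `|` F'); first by rewrite finite_setU.
by move=> y xy; split; [apply: FA|apply: FB] => j Fj; apply: xy; [left|right].
Qed.

Lemma closureP_same_cell A x : t_closure clopen_topology A x <->
  forall F, finite_set F -> exists2 y, A y & same_cell F x y.
Proof.
split=> [clA F finF|clA V oV Vx].
  have [|y [xy Ay]] := clA _ (@open_same_cell F x finF); first by [].
  by exists y.
have [F finF FV] := oV x Vx; have [y Ay xy] := clA F finF.
by exists y; split=> //; exact: FV.
Qed.

Lemma clopen_topology_zero_dimensional : t_zero_dimensional clopen_topology.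
Proof.
move=> V x oV Vx; have [F finF FV] := oV x Vx.
by exists (same_cell F x); split; first exact: clopen_same_cell.
Qed.

Lemma clopen_topology_hausdorff :
  (forall x y, x <> y -> exists j, ~ (U j y <-> U j x)) ->
  t_hausdorff clopen_topology.
Proof.
move=> sep x y /sep [j nxy]; exists (same_cell [set j] x), (same_cell [set j] y).
do 2 (split; first exact: open_same_cell).
split=> //; split=> //; apply/seteqP; split=> // z [xz yz]; apply: nxy.
by rewrite -xz // yz.
Qed.

End ClopenSubbase.

(** * The space on C and omega_1 *)

Section Space.
Variables (W : Type) (lt : W -> W -> Prop).
Hypothesis omega1W : is_omega1 lt.
Variables (G H : set Efun).
Hypotheses (GE : G `<=` inE_) (HE : H `<=` inE_).
Variable phi : W -> cantor_space.
Hypothesis phi_bij : bijective phi.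
Variable f : W -> stage W.
Hypothesis good_f : forall a,
  good lt G H (even_bits \o phi) (odd_bits \o phi) a f.

Local Notation wle := (wle lt).
Implicit Types (a b g : W) (j : clopen_index W) (F : set (clopen_index W)).

Definition subbase j : set (Cset + W)%type :=
  [set x | match x with inl c => trace f j c.1 c | inr g => member f g j end].

Definition space_topology := clopen_topology subbase.

Local Notation tau := space_topology.

Lemma layered_trace_good j : layered (trace f j).
Proof.
case: j => [[k|i]|[b []]] /=.
- exact: layered_single.
- exact: layered_half.
- exact: good_lu (good_f b).
- exact: good_lv (good_f b).
Qed.

(** Seeds have infinite domain. Hence each layer of C is a clopen set free of ordinals. *)
Lemma member_single g k : ~ member f g (inl (inl k)).
Proof.
have [infs _] := HE (good_seed (good_f g)).
apply: (ae_disjN infs); apply: filterS (nbhs_infty_gt k) => n kn.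
by apply/seteqP; split=> // c [_ [_ nk]]; rewrite nk ltnn in kn.
Qed.

Lemma member_upto_avoid g b e : lt g b -> ~ member f g (inr (b, e)).
Proof.
case: e => gb; first exact: good_avoid (good_f b) _ gb.
by apply: good_avoidv (good_f b) _ _; right.
Qed.

Lemma member_self g : member f g (inr (g, true)).
Proof. exact: good_member (good_f g). Qed.

Lemma trace_single c k : trace f (inl (inl k)) c.1 c <-> c.1 = k.
Proof. by split=> [[]//|ck]; split. Qed.

Lemma trace_half c i : trace f (inl (inr i)) c.1 c <-> c.2 i = true.
Proof. by split=> [[]//|ci]; split. Qed.

Lemma separated x y : x <> y -> exists j, ~ (subbase j y <-> subbase j x).
Proof.
have CW c g : ~ (subbase (inl (inl c.1)) (inl c) <->
                 subbase (inl (inl c.1)) (inr g)).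
  by move=> cg; apply: (@member_single g c.1); apply/cg/trace_single.
case: x y => [c|g] [c'|g'] xy.
- apply: contrapT => nj; apply: xy; congr inl.
  have same j : subbase j (inl c') <-> subbase j (inl c).
    by apply: contrapT => sj; apply: nj; exists j.
  clear nj; case: c c' same => [n y] [n' y'] same; congr (_, _).
    by have /same/trace_single := (trace_single (n', y') n').2 erefl.
  apply/funext => i; apply/idP/idP => yi.
    by have /same/trace_half := (trace_half (n, y) i).2 yi.
  by have /same/trace_half := (trace_half (n', y') i).2 yi.
- by exists (inl (inl c.1)) => gc; apply: (CW c g'); split=> /gc.
- by exists (inl (inl c'.1)); exact: CW.
have gg' : g <> g' by move=> gg'; apply: xy; rewrite gg'.
(* The set [lu] of the larger ordinal contains it and misses the smaller one. *)
have [[gE|lt_g]|[gE|lt_g]] := wle_total omega1W g g'; rewrite ?gE // in gg' *.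
  exists (inr (g', true)) => gg; apply: (member_upto_avoid lt_g (e := true)).
  exact/gg/member_self.
exists (inr (g, true)) => gg; apply: (member_upto_avoid lt_g (e := true)).
exact/gg/member_self.
Qed.

(** At a stage beyond all indices in [F] the cell is positive, hence has a point. *)
Lemma attached_closure b h g : attached f b h g ->
  forall F, finite_set F -> exists2 c, Rg h c & same_cell subbase F (inr g) (inl c).
Proof.
move=> bhg F finF.
have /HE [_ hC] : H h.
  by case: bhg => -[-> _]; [exact: good_seed (good_f b)|exact: good_att_in (good_f b)].
have gb : wle g b by case: bhg => -[_ ->]; [left|exact: good_pt (good_f b)].
have [a ba Fa] := finite_upto omega1W b finF.
have ga := wle_trans omega1W gb ba.
have [n [c [hc cF]]] := positive_inhabited HE
  (good_cell (good_f a) ba bhg ga finF Fa).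
exists c; first by exists n => //; exists c.
move=> j Fj; rewrite /subbase /= (hC _ _ hc); exact: cF.
Qed.

Lemma near_same_cell c F : finite_set F ->
  \forall c' \near c, same_cell subbase F (inl c) (inl c').
Proof.
move=> finF.
apply: (@filter_finite_forall _ _ (nbhs c) F (fun j c' =>
  trace f j c'.1 c' <-> trace f j c.1 c)) => // j Fj.
have [oj cj] := layered_clopen (layered_trace_good j).
have [jc|jc] := pselect (trace f j c.1 c).
  by apply: filterS (open_nbhs_nbhs (conj oj jc)) => c' jc'; split.
by apply: filterS (open_nbhs_nbhs (conj (closed_openC cj) jc)) => c' jc'; split.
Qed.

Lemma open_inlP (V : set Cset) :
  open V <-> exists2 V', tau V' & V = inl @^-1` V'.
Proof.
split=> [/open_CsetP oV|[V' oV' ->]].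
  exists (inl @` V); last first.
    by apply/seteqP; split=> [c Vc|c [c' Vc' [<-]]//]; exists c.
  move=> _ [c Vc <-]; have [m mV] := oV c Vc.
  (* The layer index excludes the ordinals and fixes the first coordinate; the half-spaces fix the
     first [m] bits. *)
  exists ([set inl (inl c.1)] `|` (fun i => inl (inr i)) @` `I_m).
    by rewrite finite_setU; split; [exact: finite_set1|exact: finite_image].
  move=> [c'|g] same; last first.
    case: (@member_single g c.1); apply/(same (inl (inl c.1))); first by left.
    exact/trace_single.
  exists c' => //; apply: mV; split.
    apply/trace_single/(same (inl (inl c.1))); first by left.
    exact/trace_single.
  move=> i im; have ci := same (inl (inr i)) (or_intror (ex_intro2 _ _ i im erefl)).
  apply/idP/idP => yi.
    by apply/trace_half/ci/trace_half.
  by apply/trace_half/ci/trace_half.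
rewrite openE => c V'c; have [F finF FV] := oV' _ V'c.
by apply: filterS (near_same_cell c finF) => c' /FV.
Qed.

Lemma open_range_inl : tau (range inl).
Proof.
move=> _ [c _ <-]; exists [set inl (inl c.1)]; first exact: finite_set1.
move=> [c'|g] same; first by exists c'.
by case: (@member_single g c.1); apply/(same (inl (inl c.1)))/trace_single.
Qed.

Lemma dense_range_inl : t_closure tau (range inl) = setT.
Proof.
apply/seteqP; split=> // x _; apply/closureP_same_cell => F finF.
case: x => [c|g]; first by exists (inl c) => //; exists c.
have [|c _ cF] := @attached_closure g (seed (f g)) g _ F finF; first by left.
by exists (inl c) => //; exists c.
Qed.

(** The set [lu] of [w] contains [w] and misses all earlier points, so a point of [I] found in it is
    [w] or later. *)
Lemma left_separated : t_left_separated tau inr lt.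
Proof.
move=> I Iinit w /closureP_same_cell clI.
have [_ [y Iy <-] wy] := clI [set inr (w, true)] (finite_set1 _).
have [->//|/(Iinit _ _ Iy)//|yw] : [\/ w = y, lt w y | lt y w].
  have [[->|yw]|[->|wy']] := wle_total omega1W y w.
  - by constructor 1.
  - by constructor 3.
  - by constructor 1.
  - by constructor 2.
case: (@member_upto_avoid y w true yw).
by apply/(wy (inr (w, true))) => //; exact: member_self.
Qed.

Lemma closure_G k : G k -> t_closure tau (inl @` Rg k) `&` range inr = set0.
Proof.
move=> Gk; apply/seteqP; split=> // x [clx [g _ gx]].
move: clx; rewrite -gx => /closureP_same_cell cl.
(* The stage must not precede [g], because its [lv] is known to avoid only the points up to that
   stage. *)
have [a ga ak] := odd_bits_cofinal omega1W phi_bij (layer_code k) g.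
have [_ [c [n _ kc] <-] gc] := cl [set inr (a, false)] (finite_set1 _).
apply: (good_avoidv (good_f a) ga); apply/(gc (inr (a, false))) => //=.
have [_ kC] := GE Gk; rewrite (kC _ _ kc).
exact: (good_cover (good_f a) Gk (esym ak)).
Qed.

Lemma closure_H h : H h -> t_closure tau (inl @` Rg h) `&` range inr !=set0.
Proof.
move=> Hh; have [a ah] := even_bits_onto phi_bij (layer_code h).
exists (inr (pt (f a))); split; last by exists (pt (f a)).
apply/closureP_same_cell => F finF.
have [|c [n _ ac] cF] := @attached_closure a (att (f a)) (pt (f a)) _ F finF.
  by right.
(* [att] lies only in the closure of the layers of [h], but the cell is open in C, so [h] meets it
   near [c]. *)
have ch := good_att (good_f a) Hh (esym ah) ac.
have [c' [hc' cc']] := ch _ (near_same_cell c finF).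
exists (inl c'); first by exists c' => //; exists n => //; exists c'.
by move=> j Fj; rewrite cc' //; exact: cF.
Qed.

(** C is second countable: one point of [A] is picked in each cylinder meeting [A]. *)
Lemma countably_tight_layers (A : set (Cset + W)%type) x :
  t_closure tau (A `&` range inl) x ->
  exists2 B, B `<=` A /\ countable B & t_closure tau B x.
Proof.
move=> /closureP_same_cell clA.
pose cyl (q : nat * seq bool) c := c.1 = q.1 /\
  forall i, (i < size q.2)%N -> c.2 i = nth false q.2 i.
have /choice [pick pickP] : forall q, exists p : Cset,
    (exists2 c, A (inl c) & cyl q c) -> A (inl p) /\ cyl q p.
  move=> q; have [[c Ac qc]|nc] := pselect (exists2 c, A (inl c) & cyl q c).
    by exists c.
  by exists point.
exists (A `&` (inl \o pick) @` setT).
  split; first by move=> y [].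
  apply: (@subset_countable _ _ ((inl \o pick) @` setT)); first by move=> y [].
  exact: countable_image.
apply/closureP_same_cell => F finF.
have [y [Ac [c _ cy]] xc] := clA F finF; rewrite -cy in Ac xc.
have /nbhs_near_to [m mF] := near_same_cell c finF.
pose q := (c.1, mkseq c.2 m).
have [|Ap [p1 p2]] := pickP q.
  by exists c => //; split=> // i; rewrite size_mkseq => im; rewrite nth_mkseq.
exists (inl (pick q)); first by split=> //; exists q.
have cp : near_to m c (pick q).
  by split=> // i im; rewrite p2 ?size_mkseq // nth_mkseq.
by move=> j Fj; rewrite (mF _ cp) //; exact: xc.
Qed.

(* The countable set is obtained by closing [g] under initial segments and under
   picking a point of [A] for every finite set of indices already reached: the
   clopen sets created later contain no point of it. *)
Lemma countably_tight_points (A : set (Cset + W)%type) x :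
  t_closure tau (A `&` range inr) x ->
  exists2 B, B `<=` A /\ countable B & t_closure tau B x.
Proof.
case: x => [c|g] /closureP_same_cell clA.
  (* This case is void: the layer of [c] is a neighbourhood without ordinals. *)
  have [y [_ [g _ gy]] cg] := clA [set inl (inl c.1)] (finite_set1 _).
  rewrite -gy in cg.
  by case: (@member_single g c.1); apply/(cg (inl (inl c.1)))/trace_single.
have /choice [pick pickP] : forall F, exists w, finite_set F ->
    A (inr w) /\ same_cell subbase F (inr g) (inr w).
  move=> F; have [/clA [y [Aw [w _ wy]] gw]|nF] := pselect (finite_set F).
    by exists w; rewrite wy.
  by exists g.
pose fin (B : set W) := [set F | F `<=` indices_over B /\ finite_set F].
pose next (B : set W) := \bigcup_(b in B `|` pick @` fin B) [set y | wle y b].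
pose B k := iter k next [set g].
have B_next k : B k `<=` B k.+1 by move=> b Bb; exists b; [left|left].
have B_mono k m : (k <= m)%N -> B k `<=` B m.
  move=> /subnK <-; elim: (m - k)%N => // i IH.
  exact: subset_trans IH (B_next _).
have cB k : countable (B k).
  elim: k => [|k IH]; first exact: countable1.
  apply: bigcup_countable => [|b _].
    apply: countableU => //; apply: countable_image.
    exact/countable_finite_subset/countable_indices_over.
  apply: (@subset_countable _ _ ([set b] `|` [set y | lt y b])).
    by move=> y [->|yb]; [left|right].
  by apply: countableU; [exact: countable1|exact: (countable_wlt omega1W)].
pose D := \bigcup_k B k.
have later w b : D w -> ~ D b -> lt w b.
  move=> [k _ Bw] nDb; apply: contrapT => /(wltNge omega1W) bw.
  by apply: nDb; exists k.+1 => //; exists w => //; left.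
exists (A `&` inr @` D).
  split; first by move=> y [].
  apply: (@subset_countable _ _ (inr @` D)); first by move=> y [].
  by apply: countable_image; exact: bigcup_countable.
apply/closureP_same_cell => F finF.
pose F0 := F `&` indices_over D.
have finF0 : finite_set F0 by apply: finite_setIl.
have [|||k _ F0k] := @finite_directed _ _ setT (fun k => indices_over (B k)) _ _
  F0 finF0.
- by exists 0%N.
- move=> i j _ _; exists (maxn i j) => // l [|]; case: l => [//|p] /=;
  by apply: B_mono; rewrite ?leq_maxl ?leq_maxr.
- by move=> [i|p] [_ /=]; [exists 0%N|move=> [k _ Bk]; exists k].
have [Aw gw] := pickP F0 finF0.
have Dw : D (pick F0).
  by exists k.+1 => //; exists (pick F0); [right; exists F0|left].
have Dg : D g by exists 0%N.
exists (inr (pick F0)); first by split=> //; exists (pick F0).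
move=> j Fj; have [Dj|nDj] := pselect (indices_over D j); first exact: gw.
case: j Fj nDj => [i _ /(_ I) []|[b e] Fj nDj].
by split=> [/member_upto_avoid|/member_upto_avoid]; case; exact: later.
Qed.

(** A point in the closure of [A] is in the closure of its part in C or of its part in omega_1. *)
Lemma countably_tight : t_countable_tightness tau.
Proof.
move=> A x clA.
have [clA1|nclA1] := pselect (t_closure tau (A `&` range inl) x).
  exact: countably_tight_layers.
apply: countably_tight_points; apply/closureP_same_cell => F2 finF2.
apply: contrapT => nF2; apply: nclA1; apply/closureP_same_cell => F1 finF1.
have /closureP_same_cell /(_ (F1 `|` F2)) [|y Ay xy] := clA.
  by rewrite finite_setU.
case: y Ay xy => [c|g] Ay xy.
  by exists (inl c); [split=> //; exists c|move=> j Fj; apply: xy; left].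
case: nF2; exists (inr g); first by split=> //; exists g.
by move=> j Fj; apply: xy; right.
Qed.

End Space.

Theorem theorem2p6 (W : Type) (lt : W -> W -> Prop)
  (omega1W : is_omega1 lt) (CH : CH_for W)
  (G H : set Efun) (GE : G `<=` inE_) (HE : H `<=` inE_)
  (Hdense : denseE H) (Hshr : shrinkable H) (Hlarge : large G H) :
  exists tau : set (set (Cset + W)%type),
    [/\ [/\ t_is_topology tau, t_zero_dimensional tau & t_hausdorff tau],
        (* (i) *)
        t_countable_tightness tau /\ t_left_separated tau inr lt,
        (* (ii) *)
        [/\ tau (range inl), t_closure tau (range inl) = setT &
            forall U : set Cset, open U <-> exists2 V, tau V & U = inl @^-1` V],
        (* (iii) *)
        (forall g, G g -> t_closure tau (inl @` Rg g) `&` range inr = set0) &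
        (* (iv) *)
        (forall h, H h -> t_closure tau (inl @` Rg h) `&` range inr !=set0)].
Proof.
have [phi phi_bij] := CH.
have [f good_f] := good_stages omega1W GE HE Hdense Hshr Hlarge
  (even_bits \o phi) (odd_bits \o phi) phi_bij.
exists (space_topology f); split.
- split; [exact: clopen_topologyP|exact: clopen_topology_zero_dimensional|].
  exact: clopen_topology_hausdorff (separated omega1W HE good_f).
- split; [exact: countably_tight good_f|exact: left_separated good_f].
- split; [exact: open_range_inl good_f|exact: dense_range_inl good_f|].
  exact: open_inlP good_f.
- exact: closure_G good_f.
- exact: closure_H good_f.
Qed.
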